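(* Let $\{l_1,l_2,l_3,l_4,l_5\}$ be a set of lines in $L_8$ giving an $A_4^8(1)$-polytope in $4_{21}$. Then there is a unique subset of $\{l_1,\dots,l_5\}$ (of four lines) which gives a cornered $A_3^8(1)$-polytope.
   Context: $S_8$ is a del Pezzo surface obtained by blowing up $\mathbb{P}^2$ at $8$ points (with $-K_{S_8}$ ample). $\mathrm{Pic}\,S_8=\mathbb{Z}h\oplus\mathbb{Z}e_1\oplus\dots\oplus\mathbb{Z}e_8$ with intersection form $h^2=1$, $h\cdot e_i=0$, $e_i\cdot e_j=-\delta_{ij}$, and $K_{S_8}=-3h+\sum_{i=1}^8 e_i$. A line is a class $l\in\mathrm{Pic}\,S_8$ with $l^2=l\cdot K_{S_8}=-1$; $L_8$ is the set of lines, which is the vertex set of the Gosset polytope $4_{21}$ (the convex hull of $L_8$). An $A_n^8(1)$-polytope in $4_{21}$ is a set of $n+1$ distinct lines in $L_8$ with pairwise intersection number $1$. The vertex figure of $l\in L_8$ is $\{l'\in L_8: l'\cdot l=0\}$. An $A_n^8(1)$-polytope is cornered if there is a line $l\in L_8$ whose vertex figure contains all its lines. *)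

(* Defs.v *)
From mathcomp Require Export all_boot all_order all_algebra.
From mathcomp Require Export finmap.

Set Implicit Arguments.
Unset Strict Implicit.
Unset Printing Implicit Defensive.

Import GRing.Theory.
Local Open Scope ring_scope.

(* Pic S_8 = Z h (+) Z e_1 (+) ... (+) Z e_8: entry 0 of a row vector is the
   coefficient of h and entry i (for i = 1, ..., 8) is the coefficient of e_i.
   Everything below depends on the del Pezzo surface S_8 only through this
   lattice, its intersection form and the class K. *)
Notation pic8 := 'rV[int]_(1 + 8).

Definition h : pic8 := delta_mx 0 0.

(* exc i is e_(i+1): 'I_8 is 0, ..., 7. *)
Definition exc (i : 'I_8) : pic8 := delta_mx 0 (rshift 1 i).

(* The form is diagonal in the basis h, e_1, ..., e_8, with signature (1, 8). *)
Definition inter (D D' : pic8) : int :=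
  D 0 0 * D' 0 0 - \sum_(i < 8) D 0 (rshift 1 i) * D' 0 (rshift 1 i).

Definition canon : pic8 := \sum_(i < 8) exc i - h *+ 3.

(* Membership in L_8, the vertex set of the Gosset polytope 4_21. *)
Definition is_line (l : pic8) : bool :=
  (inter l l == -1) && (inter l canon == -1).

Definition vertex_figure (l : pic8) : pred pic8 :=
  fun l' => is_line l' && (inter l' l == 0).

(* S is an A_n^8(1)-polytope in 4_21. *)
Definition A1_polytope (n : nat) (S : {fset pic8}) : Prop :=
  [/\ #|` S| = n.+1,
      {in S, forall l, is_line l}
    & {in S &, forall l l', l != l' -> inter l l' = 1}].

Definition cornered (S : {fset pic8}) : Prop :=
  exists2 l : pic8, is_line l & {in S, forall l', vertex_figure l l'}.

Definition cornered_A1_polytope (n : nat) (S : {fset pic8}) : Prop :=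
  A1_polytope n S /\ cornered S.

(* Main.v *)
Require Import Defs.
From HB Require Import structures.
From mathcomp Require Import zify ring.

(** Adding K to a line [l] gives a class [root l] orthogonal to K with square
    -2, that is, a root of the copy of E_8 (with negated form) formed by the
    orthogonal complement of K; moreover [root l . root l' = l . l' - 1].  So
    lines with pairwise intersection number 1 are orthogonal roots, and two
    lines are disjoint when their roots have product -1.

    If [l] is disjoint from four lines with orthogonal roots r_1, ..., r_4,
    then the class [2 (root l) - (r_1 + ... + r_4)] is orthogonal to K and has
    square 0, so it vanishes because the form is negative definite there.
    Conversely, if r_1 + ... + r_4 = 2 D, then D is a root and D - K is a line
    disjoint from the four.  Hence a set of four lines is cornered exactly when
    the sum of its roots is divisible by 2 ([cornered_halvable]), and the
    theorem becomes a statement about five orthogonal roots: exactly one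
    four-element subset has a sum divisible by 2.

    Existence: modulo 2 the form on Pic is the standard dot product on F_2^9,
    and the five roots span a totally isotropic subspace.  Such a subspace has
    dimension at most 4, so some nonempty subset of the roots, of size k say,
    sums to 2 D ([even_sum_of_even_inter]).  Then 4 D^2 = -2 k, and D^2 is even
    because K is a characteristic vector; so 4 divides k and k = 4
    ([halvable_card]).

    Uniqueness: if S and T have sums 2 D and 2 E, then 4 (D . E) is
    -2 |S meet T|, so |S meet T| is even ([halvable_even_meet]), whereas two
    distinct four-element subsets of a five-element set have three elements in
    common. *)

Set Implicit Arguments.
Unset Strict Implicit.
Unset Printing Implicit Defensive.

Import GRing.Theory Num.Theory.
Local Open Scope ring_scope.

(** * The lattice Pic and its canonical class *)

Lemma interC (D E : pic8) : inter D E = inter E D.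
Proof.
by rewrite /inter mulrC; congr (_ - _); apply: eq_bigr => i _; rewrite mulrC.
Qed.

Lemma inter_is_additive (D : pic8) : zmod_morphism (inter D).
Proof.
move=> E F; rewrite /inter !mxE.
under eq_bigr => i _ do rewrite !mxE mulrDr mulrN.
by rewrite big_split sumrN /=; ring.
Qed.

HB.instance Definition _ (D : pic8) :=
  GRing.isZmodMorphism.Build pic8 int (inter D) (inter_is_additive D).

Lemma inter_sumr (T : Type) (s : seq T) (F : T -> pic8) (D : pic8) :
  inter D (\sum_(i <- s) F i) = \sum_(i <- s) inter D (F i).
Proof. exact: raddf_sum. Qed.

Lemma interDr (D E F : pic8) : inter D (E + F) = inter D E + inter D F.
Proof. exact: raddfD. Qed.

Lemma interDl (D E F : pic8) : inter (D + E) F = inter D F + inter E F.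
Proof. by rewrite interC interDr !(interC F). Qed.

Lemma interBr (D E F : pic8) : inter D (E - F) = inter D E - inter D F.
Proof. exact: raddfB. Qed.

Lemma interBl (D E F : pic8) : inter (D - E) F = inter D F - inter E F.
Proof. by rewrite interC interBr !(interC F). Qed.

Lemma interMnr (D E : pic8) (k : nat) : inter D (E *+ k) = inter D E *+ k.
Proof. exact: raddfMn. Qed.

Lemma interMnl (D E : pic8) (k : nat) : inter (D *+ k) E = inter D E *+ k.
Proof. by rewrite interC interMnr interC. Qed.

Lemma canon0 : canon 0 0 = - 3%:R.
Proof.
rewrite /canon !mxE summxE big1 ?sub0r // => i _; by rewrite /exc mxE.
Qed.

Lemma canonS (i : 'I_8) : canon 0 (rshift 1 i) = 1.
Proof.
rewrite /canon /h !mxE summxE (bigD1 i) //= big1 => [|j ji].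
  by rewrite /exc !mxE !eqxx.
by rewrite /exc mxE /= eq_rshift eq_sym (negbTE ji).
Qed.

Lemma inter_canonr (D : pic8) :
  inter D canon = - (3 * D 0 0 + \sum_(i < 8) D 0 (rshift 1 i)).
Proof.
rewrite /inter canon0; under eq_bigr => i _ do rewrite canonS mulr1.
ring.
Qed.

Lemma inter_canon_canon : inter canon canon = 1.
Proof.
rewrite inter_canonr canon0.
by under eq_bigr => i _ do rewrite canonS; rewrite sumr_const card_ord.
Qed.

Lemma even_succ_mul (x : int) : (2 %| x * (x + 1))%Z.
Proof.
have [y xy] : exists y : int, x = y *+ 2 \/ x = y *+ 2 + 1.
  by exists (divz x 2); have := divz_eq x 2; lia.
case: xy => ->; apply/dvdzP.
  by exists (y * (y *+ 2 + 1)); ring.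
by exists ((y *+ 2 + 1) * (y + 1)); ring.
Qed.

(** The reason is that x^2 and x have the same parity, while all the
    coordinates of K are odd. *)
Lemma canon_characteristic (D : pic8) : (2 %| inter D D + inter D canon)%Z.
Proof.
have -> : inter D D + inter D canon = D 0 0 * (D 0 0 + 1) - 4 * D 0 0
    - \sum_(i < 8) D 0 (rshift 1 i) * (D 0 (rshift 1 i) + 1).
  by rewrite inter_canonr /inter !big_ord_recr !big_ord0 /=; ring.
rewrite rpredB ?rpred_sum // => [|i _]; last exact: even_succ_mul.
by rewrite rpredB ?even_succ_mul // dvdz_mulr.
Qed.

(** Negative definiteness of the form on the orthogonal complement of K comes
    from the identity -9 D^2 = x_0^2 + sum_i (3 x_i + x_0)^2, valid for
    [D = (x_0; x_1, ..., x_8)] with D . K = 0. *)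
Lemma orthogonal_canon_definite (D : pic8) :
  inter D canon = 0 -> inter D D = 0 -> D = 0.
Proof.
move=> DK DD.
have key : D 0 0 ^+ 2 + \sum_(i < 8) (3 * D 0 (rshift 1 i) + D 0 0) ^+ 2 = 0.
  (* Without D . K = 0, the identity has the correction term -6 x_0 (D . K). *)
  transitivity (- 9%:R * inter D D - 6%:R * D 0 0 * inter D canon).
    rewrite inter_canonr /inter !big_ord_recr !big_ord0 /=; ring.
  by rewrite DK DD !mulr0 subr0.
have S0 : 0 <= \sum_(i < 8) (3 * D 0 (rshift 1 i) + D 0 0) ^+ 2.
  by apply: sumr_ge0 => i _; apply: sqr_ge0.
move/eqP: key; rewrite paddr_eq0 ?sqr_ge0 // sqrf_eq0 => /andP[/eqP D0].
rewrite psumr_eq0 => [/allP Di|i _]; last exact: sqr_ge0.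
apply/rowP => k; rewrite mxE; case: (splitP k) => j kj.
  by have -> : k = 0 by apply: val_inj; rewrite /= kj ord1.
have := Di j (mem_index_enum j); rewrite /= sqrf_eq0 D0 addr0.
rewrite mulf_eq0 /= => /eqP <-.
by congr (D _ _); apply: val_inj.
Qed.

(** * Lines as roots *)

Definition root (l : pic8) : pic8 := l + canon.

Lemma inter_root_canon (l : pic8) : is_line l -> inter (root l) canon = 0.
Proof.
by case/andP=> _ /eqP lK; rewrite interDl lK inter_canon_canon.
Qed.

Lemma inter_root (l l' : pic8) :
  is_line l -> is_line l' -> inter (root l) (root l') = inter l l' - 1.
Proof.
move=> hl /andP[_ /eqP l'K].
by rewrite interDr inter_root_canon // addr0 interDl (interC canon) l'K.
Qed.

Lemma inter_root_self (l : pic8) :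
  is_line l -> inter (root l) (root l) = - 2%:R.
Proof. by move=> hl; rewrite inter_root //; case/andP: hl => /eqP->. Qed.

(** * Sets of orthogonal roots and their half sums *)

Definition root_sum (S : {fset pic8}) : pic8 := \sum_(l <- S) root l.

Definition halvable (S : {fset pic8}) : Prop :=
  exists D : pic8, D *+ 2 = root_sum S.

Lemma inter_sum_canon (n : nat) (S : {fset pic8}) :
  A1_polytope n S -> inter (root_sum S) canon = 0.
Proof.
case=> _ hS _; rewrite interC inter_sumr big_seq big1 // => l lS.
by rewrite interC inter_root_canon ?hS.
Qed.

Lemma sub_A1_polytope (n k : nat) (P S : {fset pic8}) :
  A1_polytope n P -> (S `<=` P)%fset -> #|` S| = k.+1 -> A1_polytope k S.
Proof.
case=> _ hP PP /fsubsetP SP cS; split=> // [l /SP /hP // | l l' /SP lP /SP].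
exact: PP.
Qed.

Lemma inter_root_sum (n : nat) (P S : {fset pic8}) (l : pic8) :
  A1_polytope n P -> (S `<=` P)%fset -> l \in P ->
  inter (root l) (root_sum S) = - 2%:R *+ (l \in S).
Proof.
move=> [_ hP PP] /fsubsetP SP lP; rewrite inter_sumr.
have off x : x \in S -> x != l -> inter (root l) (root x) = 0.
  by move=> /SP xP xl; rewrite inter_root ?hP // PP // eq_sym.
have [lS|lS] := boolP (l \in S).
  rewrite (big_fsetD1 l) //= inter_root_self ?hP // big_seq big1 ?addr0 //.
  by move=> x; rewrite !inE => /andP[xl xS]; apply: off.
rewrite big_seq big1 // => x xS; apply: off => //.
by apply: contraNneq lS => <-.
Qed.

Lemma inter_root_sums (n : nat) (P S T : {fset pic8}) :
  A1_polytope n P -> (S `<=` P)%fset -> (T `<=` P)%fset ->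
  inter (root_sum S) (root_sum T) = - 2%:R *+ #|` (S `&` T)%fset|.
Proof.
move=> hP SP TP; rewrite interC inter_sumr big_seq.
under eq_bigr => l lS.
  rewrite interC (inter_root_sum hP TP) ?(fsubsetP SP) // mulrb.
  over.
rewrite -big_seq -big_mkcond /= big_fset_condE /=.
rewrite big_const_seq count_predT /= iter_addr_0.
by congr (_ *+ #|` _|); apply/fsetP => x; rewrite !inE.
Qed.

(** A line disjoint from the four lines of [S] can only be the one whose root is
    half the sum of the four roots; the converse is a computation with the
    products of this half sum. *)
Lemma cornered_halvable (S : {fset pic8}) :
  A1_polytope 3 S -> cornered S <-> halvable S.
Proof.
move=> hS; have [cS lS _] := hS.
have SS : inter (root_sum S) (root_sum S) = - 8%:R.
  by rewrite (inter_root_sums hS) ?fsubset_refl // fsetIid cS.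
split=> [[l hl lc]|[D DS]].
  exists (root l); apply/eqP; rewrite -subr_eq0; apply/eqP.
  have rS : inter (root l) (root_sum S) = - 4%:R.
    rewrite inter_sumr big_seq (eq_bigr (fun=> - 1)) => [|x xS].
      by rewrite -big_seq big_const_seq count_predT cS.
    have /andP[hx /eqP xl] := lc _ xS.
    by rewrite inter_root // interC xl.
  have Sr := inter_sum_canon hS.
  apply: orthogonal_canon_definite.
    by rewrite interBl interMnl inter_root_canon // Sr.
  (* The square of 2 (root l) - root_sum S is 4 (-2) - 4 (-4) + (-8) = 0. *)
  rewrite interBr interMnr !interBl !interMnl inter_root_self //.
  by rewrite (interC _ (root l)) rS SS.
have DK : inter D canon = 0.
  by have := inter_sum_canon hS; rewrite -DS interMnl; lia.
have DD : inter D D = - 2%:R.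
  by move: SS; rewrite -DS interMnr interMnl; lia.
have rD l : l \in S -> inter (root l) D = -1.
  move=> Sl; have := inter_root_sum hS (fsubset_refl S) Sl.
  by rewrite Sl -DS interMnr; lia.
have lD : is_line (D - canon).
  rewrite /is_line !(interBl D canon) !(interBr _ D canon) (interC canon D).
  by rewrite DD DK inter_canon_canon.
exists (D - canon) => // l Sl; rewrite /vertex_figure lS //=.
have := inter_root (lS _ Sl) lD; rewrite {2}/root subrK rD //; lia.
Qed.

(** If the n+1 roots sum to 2 D, then 4 D^2 = -2 (n+1), and D^2 is even as K is
    characteristic and D . K = 0. *)
Lemma halvable_card (n : nat) (S : {fset pic8}) :
  A1_polytope n S -> halvable S -> (4 %| n.+1)%N.
Proof.
move=> hS [D DS]; have [cS _ _] := hS.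
have DK : inter D canon = 0.
  by have := inter_sum_canon hS; rewrite -DS interMnl; lia.
have := inter_root_sums hS (fsubset_refl S) (fsubset_refl S).
rewrite fsetIid cS -DS interMnr interMnl.
have := canon_characteristic D; rewrite DK; lia.
Qed.

(** * Linear dependence modulo 2 *)

Lemma F2_subr (a b : 'F_2) : a - b = a + b.
Proof. by rewrite oppr_pchar2 // pchar_Fp. Qed.

Lemma F2_eq1 (a : 'F_2) : a = (a != 0)%:R.
Proof. by case: a => [[|[|[]]] ?] //; apply: val_inj. Qed.

(** The reductions modulo 2 of the [r i] are the rows of a matrix A over F_2,
    and A A^T = 0 because signs disappear modulo 2; so twice the rank of A is at
    most 9.  With at least five rows, some nonempty set of rows sums to 0. *)
Lemma even_sum_of_even_inter (n : nat) (r : 'I_n -> pic8) :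
    (4 < n)%N -> (forall i j, (2 %| inter (r i) (r j))%Z) ->
  exists I : {set 'I_n}, I != set0 /\
    exists D : pic8, D *+ 2 = \sum_(i in I) r i.
Proof.
move=> n4 ev; have p2 := pchar_Fp (isT : prime 2).
pose A : 'M['F_2]_(n, 1 + 8) := \matrix_(i, k) (r i 0 k)%:~R.
have AA : A *m A^T = 0.
  apply/matrixP => i j; rewrite !mxE.
  transitivity ((inter (r i) (r j))%:~R : 'F_2); last first.
    by apply/eqP; rewrite -(dvdz_pcharf p2) ev.
  rewrite /inter rmorphB /= rmorphM rmorph_sum F2_subr big_split_ord big_ord1.
  congr (_ + _).
    by rewrite !mxE; congr (_%:~R * _%:~R); congr (r _ _ _); apply: val_inj.
  by apply: eq_bigr => k _; rewrite !mxE rmorphM.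
have := mulmx0_rank_max AA; rewrite mxrank_tr => rkA.
have : ~~ row_free A by rewrite /row_free; lia.
rewrite -kermx_eq0 => /rowV0Pn[v /sub_kermxP vA v0].
(* Over F_2 a row dependence is a set: the support of its coefficients. *)
exists [set i | v 0 i != 0]; split.
  apply: contra_neq v0 => I0; apply/rowP => i; rewrite mxE; apply/eqP.
  by have := in_set0 i; rewrite -I0 inE => /negbFE.
pose s : pic8 := \sum_(i in [set i | v 0 i != 0]) r i.
have ev_s (k : 'I_(1 + 8)) : (2 %| s 0%R k)%Z.
  rewrite (dvdz_pcharf p2) /s summxE rmorph_sum big_mkcond /=; apply/eqP.
  transitivity ((v *m A) 0 k); last by rewrite vA mxE.
  rewrite mxE; apply: eq_bigr => i _; rewrite inE mxE.
  rewrite [in RHS](F2_eq1 (v 0 i)).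
  by case: (v 0 i != 0); rewrite ?mul1r ?mul0r.
exists (\row_k divz (s 0 k) 2); apply/rowP => k; rewrite !mxE -/s.
by rewrite -[RHS](divzK (ev_s k)) mulr_natr mulr2n.
Qed.

Lemma exists_halvable (n : nat) (P : {fset pic8}) :
    (4 <= n)%N -> A1_polytope n P ->
  exists2 S : {fset pic8}, (S `<=` P)%fset & S != fset0 /\ halvable S.
Proof.
move=> n4 hP; have [cP lP PP] := hP.
have memP (i : 'I_#|` P|) : nth 0 P i \in P by rewrite mem_nth.
have [||I [I0 [D DI]]] :=
    @even_sum_of_even_inter #|` P| (fun i => root (nth 0 P i)).
- by rewrite cP.
- move=> i j; rewrite inter_root ?lP //.
  have [->|ij] := eqVneq (nth 0 P i : pic8) (nth 0 P j).
    by have /andP[/eqP-> _] := lP _ (memP j).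
  by rewrite PP.
have inj : {in I &, injective (fun i : 'I_#|` P| => nth 0 P i : pic8)}.
  move=> i j _ _ /eqP; rewrite nth_uniq ?fset_uniq // => /eqP; exact: val_inj.
exists [fset (nth 0 P i : pic8) | i : 'I_#|` P| in I]%fset.
  by apply/fsubsetP => x /imfsetP[i _ ->].
split.
  have /set0Pn[i iI] := I0.
  by apply/fset0Pn; exists (nth 0 P i); apply/imfsetP; exists i.
exists D; rewrite DI /root_sum big_imfset //=.
by rewrite big_enum.
Qed.

(** With half sums D and E, comparing 4 (D . E) with the product of the two root
    sums shows that 2 |S meet T| is a multiple of 4. *)
Lemma halvable_even_meet (n : nat) (P S T : {fset pic8}) :
    A1_polytope n P -> (S `<=` P)%fset -> (T `<=` P)%fset ->
  halvable S -> halvable T -> ~~ odd #|` (S `&` T)%fset|.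
Proof.
move=> hP SP TP [D DS] [E ET].
have := inter_root_sums hP SP TP.
rewrite -DS -ET interMnr interMnl; lia.
Qed.

(** * The unique cornered subset *)

Local Close Scope ring_scope.
Local Open Scope fset_scope.

Theorem theorem20 (P : {fset pic8}) (hP : A1_polytope 4 P) :
  exists! S : {fset pic8}, S `<=` P /\ cornered_A1_polytope 3 S.
Proof.
have [cP _ _] := hP.
have [S SP [S0 hS]] := exists_halvable (leqnn 4) hP.
have cS : #|` S| = 4.
  have : 0 < #|` S| by rewrite cardfs_gt0.
  have := fsubset_leq_card SP; rewrite cP.
  case E: #|` S| => [|k] //.
  by have := halvable_card (sub_A1_polytope hP SP E) hS; lia.
have pS := sub_A1_polytope hP SP cS.
exists S; split; first by split=> //; split=> //; apply/(cornered_halvable pS).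
move=> T [TP [pT /(cornered_halvable pT) hT]]; have [cT _ _] := pT.
apply/eqP; rewrite eqEfcard cT cS andbT; apply/fsetIidPl/eqP.
rewrite eqEfcard fsubsetIl cS /=.
have := halvable_even_meet hP SP TP hS hT.
have UP : S `|` T `<=` P by rewrite fsubUset SP.
have := fsubset_leq_card UP; have := cardfsUI S T; rewrite cS cT cP.
by move: #|` S `&` T| #|` S `|` T| => m u; lia.
Qed.
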